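(* Let $H$ be a group which is hyperbolic relative to a collection of subgroups $\{H_\lambda\}_{\lambda\in\Lambda}\cup\{K\}$. Assume that $K$ is finitely generated and that for some $\nu\in\Lambda$ there exists a monomorphism $\iota:K\to H_\nu$. Then the HNN-extension $$G=\langle H,t\mid t^{-1}kt=\iota(k),\ k\in K\rangle$$ is hyperbolic relative to $\{H_\lambda\}_{\lambda\in\Lambda}$.
   Context: **Relative presentations.** Let $G$ be a group, $\{H_\lambda\}_{\lambda\in\Lambda}$ a collection of subgroups of $G$ and $X\subseteq G$ a subset, always assumed symmetrized ($X^{-1}=X$). $X$ is a relative generating set of $G$ with respect to $\{H_\lambda\}_{\lambda\in\Lambda}$ if $G$ is generated by $X\cup\bigcup_{\lambda}H_\lambda$. Then $G$ is a quotient of the free product $F=(\ast_{\lambda\in\Lambda}H_\lambda)\ast F(X)$, where $F(X)$ is the free group with basis $X$. If the kernel of the natural homomorphism $F\to G$ is the normal closure in $F$ of a subset $\mathcal R$, one says that $G$ has the relative presentation $\langle X, H_\lambda,\lambda\in\Lambda\mid\mathcal R\rangle$. It is finite if $X$ and $\mathcal R$ are finite (there is no finiteness restriction on $\Lambda$ or on the $H_\lambda$); if a finite relative presentation exists, $G$ is said to be finitely presented relative to $\{H_\lambda\}_{\lambda\in\Lambda}$. **Relative Dehn functions.** Put $\mathcal H=\bigsqcup_{\lambda\in\Lambda}(H_\lambda\setminus\{1\})$. For a word $W$ in the alphabet $X\cup\mathcal H$ representing $1$ in $G$, the relative area $Area^{rel}(W)$ is the smallest $k$ such that $W=\prod_{i=1}^k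 f_i^{-1}R_i^{\pm1}f_i$ in $F$ with $R_i\in\mathcal R$, $f_i\in F$. The relative Dehn function of $G$ with respect to $\{H_\lambda\}_{\lambda\in\Lambda}$ (for a finite relative presentation) is the smallest function $f:\mathbb N\to\mathbb N$ such that $Area^{rel}(W)\le f(n)$ for every $n$ and every word $W$ in $X\cup\mathcal H$ of length at most $n$ representing $1$ in $G$; it is well-defined if these relative areas are bounded for each $n$. When well-defined, it does not depend on the finite relative presentation up to the equivalence $f\preceq g\preceq f$, where $f\preceq g$ means that there are positive constants $A,B,C$ with $f(n)\le A\,g(Bn)+Cn$ for all $n$. **Relative hyperbolicity.** $G$ is hyperbolic relative to $\{H_\lambda\}_{\lambda\in\Lambda}$ if the relative Dehn function of $G$ with respect to $\{H_\lambda\}_{\lambda\in\Lambda}$ is linear; that is, $G$ is finitely presented relative to $\{H_\lambda\}_{\lambda\in\Lambda}$ and its relative Dehn function is well-defined and bounded above by $Cn$ for some constant $C$. *)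

(* Defs.v *)
From HB Require Import structures.
From mathcomp Require Import all_boot.
From mathcomp Require Import boolp classical_sets functions cardinality.

Set Implicit Arguments.
Unset Strict Implicit.
Unset Printing Implicit Defensive.

Local Open Scope group_scope.
Local Open Scope classical_set_scope.
Local Open Scope quotient_scope.

(* A subgroup of G is a predicate S : groupClosed G; subgrp S is the group it
   carries. *)
Record subgrp (G : groupType) (S : groupClosed G) := Subgrp {
  subgrp_val : G;
  subgrp_valP : subgrp_val \in S
}.

Section SubgroupType.
Variables (G : groupType) (S : groupClosed G).

Fact subgrp_closed : group_closed S.
Proof. by split; [exact: gpred1 | move=> x y; exact: gpredF]. Qed.

HB.instance Definition _ := [isSub for @subgrp_val G S].
HB.instance Definition _ := [Choice of subgrp S by <:].
HB.instance Definition _ :=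
  SubChoice_isSubGroup.Build G (mem S) (subgrp S) subgrp_closed.
End SubgroupType.

Section ImageSubgroup.
Variables (G L : groupType) (f : {multiplicative G -> L}) (S : groupClosed G).

Definition image_pred : {pred L} := mem (f @` [set` S]).

Fact image_predP y :
  reflect (exists2 x, x \in S & f x = y) (y \in image_pred).
Proof. by apply: (iffP idP) => [/set_mem|h]; last exact/mem_set. Qed.

Fact image_pred1 : 1 \in image_pred.
Proof.
apply/image_predP; exists 1; first exact: gpred1.
by apply: (mulgI (f 1)); rewrite -gmulfM !mulg1.
Qed.

Fact image_predM : mulg_closed image_pred.
Proof.
move=> _ _ /image_predP[x xS <-] /image_predP[y yS <-].
by apply/image_predP; exists (x * y); rewrite ?gpredM ?gmulfM.
Qed.

Fact image_predV : invg_closed image_pred.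
Proof.
move=> _ /image_predP[x xS <-].
apply/image_predP; exists x^-1; first by rewrite gpredV.
have [z _ f1] := image_predP _ image_pred1.
have f11 : f 1 = 1 by apply: (mulgI (f 1)); rewrite -gmulfM !mulg1.
by apply: (mulgI (f x)); rewrite -gmulfM !mulgV.
Qed.

HB.instance Definition _ := isMulClosed.Build L image_pred image_predM.
HB.instance Definition _ := isMul1Closed.Build L image_pred image_pred1.
HB.instance Definition _ := isInvClosed.Build L image_pred image_predV.
Definition image_subgroup : groupClosed L := image_pred.
End ImageSubgroup.

Definition generated (G : groupType) (A : set G) : set G :=
  [set x | forall S : groupClosed G, A `<=` [set` S] -> x \in S].

Definition finitely_generated (G : groupType) (S : groupClosed G) : Prop :=
  exists2 A : set G, finite_set A & generated A = [set` S].

Definition normal_closure (G : groupType) (R : set G) : set G :=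
  [set x | forall N : groupClosed G,
     (forall y z, y \in N -> y ^ z \in N) -> R `<=` [set` N] -> x \in N].

(* freeprod X H is the free product of the groups H i and of F(X): words in the letters
   x, x^-1 (x in X) and in the elements of the disjoint union of the H i,
   modulo free cancellation and the multiplication tables of the H i. *)
Section FreeProduct.
Variables (X I : Type) (H : I -> groupType).

Inductive fp_letter : Type :=
| FPgen of X & bool
| FPfac (i : I) of H i.

HB.instance Definition _ := gen_eqMixin fp_letter.
HB.instance Definition _ := gen_choiceMixin fp_letter.

Inductive fp_eq : seq fp_letter -> seq fp_letter -> Prop :=
| fp_refl u : fp_eq u u
| fp_sym u v : fp_eq u v -> fp_eq v u
| fp_trans u v w : fp_eq u v -> fp_eq v w -> fp_eq u w
| fp_cat u u' v v' : fp_eq u u' -> fp_eq v v' -> fp_eq (u ++ v) (u' ++ v')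
| fp_cancel x b : fp_eq [:: FPgen x b; FPgen x (~~ b)] [::]
| fp_mul i (a b : H i) : fp_eq [:: FPfac a; FPfac b] [:: FPfac (a * b)]
| fp_one i : fp_eq [:: FPfac (1 : H i)] [::].

Definition fp_rel : rel (seq fp_letter) := fun u v => `[< fp_eq u v >].

Fact fp_rel_equiv : equiv_class_of fp_rel.
Proof.
split=> [u|u v|v u w].
- exact/asboolP/fp_refl.
- by apply/asboolP/asboolP; exact: fp_sym.
- by move=> /asboolP uv /asboolP vw; apply/asboolP/(fp_trans uv).
Qed.
Canonical fp_rel_canonical := EquivRelPack fp_rel_equiv.

Definition freeprod := {eq_quot fp_rel}.
HB.instance Definition _ := Choice.on freeprod.
HB.instance Definition _ := EqQuotient.on freeprod.

Lemma fp_eqP u v : fp_eq u v <-> \pi_freeprod u = \pi_freeprod v.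
Proof.
split=> [uv|/eqmodP uv]; last exact/asboolP.
by apply/eqmodP; exact/asboolP.
Qed.

Lemma fp_reprP u : fp_eq (repr (\pi_freeprod u)) u.
Proof. by apply/fp_eqP; rewrite reprK. Qed.

Definition fp_letterV (a : fp_letter) : fp_letter :=
  match a with
  | FPgen x b => FPgen x (~~ b)
  | FPfac i h => FPfac h^-1
  end.

Definition fp_wordV (u : seq fp_letter) := rev (map fp_letterV u).

Lemma fp_letterVl a : fp_eq [:: fp_letterV a; a] [::].
Proof.
case: a => [x b|i h] /=; first by rewrite -{2}(negbK b); exact: fp_cancel.
by apply: fp_trans (fp_mul _ _) _; rewrite mulVg; exact: fp_one.
Qed.

Lemma fp_letterVr a : fp_eq [:: a; fp_letterV a] [::].
Proof.
case: a => [x b|i h] /=; first exact: fp_cancel.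
by apply: fp_trans (fp_mul _ _) _; rewrite mulgV; exact: fp_one.
Qed.

Lemma fp_wordVl u : fp_eq (fp_wordV u ++ u) [::].
Proof.
elim: u => [|a u IHu]; first exact: fp_refl.
rewrite /fp_wordV /= rev_cons cat_rcons -cat1s.
apply: fp_trans _ IHu; apply: fp_cat; first exact: fp_refl.
rewrite (catA [:: _] [:: a]); exact: (fp_cat (fp_letterVl a) (fp_refl u)).
Qed.

Lemma fp_wordVr u : fp_eq (u ++ fp_wordV u) [::].
Proof.
elim: u => [|a u IHu]; first exact: fp_refl.
rewrite /fp_wordV /= rev_cons -cats1 -cat1s !catA.
apply: fp_trans _ (fp_letterVr a).
rewrite -[X in fp_eq _ X]/([:: a] ++ [:: fp_letterV a]).
apply: fp_cat; last exact: fp_refl.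
rewrite -catA -[X in fp_eq _ X]cats0.
by apply: fp_cat (fp_refl _) IHu.
Qed.

Lemma fp_wordV_eq u v : fp_eq u v -> fp_eq (fp_wordV u) (fp_wordV v).
Proof.
move=> uv; apply: (@fp_trans _ (fp_wordV u ++ (v ++ fp_wordV v))).
  rewrite -[X in fp_eq X _]cats0; apply: fp_cat (fp_refl _) _.
  exact/fp_sym/fp_wordVr.
rewrite catA -[X in fp_eq _ X]cat0s; apply: fp_cat (fp_refl _).
by apply: fp_trans _ (fp_wordVl u); apply: fp_cat (fp_refl _) (fp_sym uv).
Qed.

Definition freeprod_one : freeprod := \pi_freeprod [::].
Definition freeprod_mul (p q : freeprod) : freeprod := \pi_freeprod (repr p ++ repr q).
Definition freeprod_inv (p : freeprod) : freeprod := \pi_freeprod (fp_wordV (repr p)).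

Lemma freeprod_mulE u v :
  freeprod_mul (\pi u) (\pi v) = \pi_freeprod (u ++ v).
Proof. by apply/fp_eqP; apply: fp_cat; exact: fp_reprP. Qed.

Lemma freeprod_invE u : freeprod_inv (\pi u) = \pi_freeprod (fp_wordV u).
Proof. by apply/fp_eqP; apply: fp_wordV_eq; exact: fp_reprP. Qed.

Fact freeprod_mulA : associative freeprod_mul.
Proof.
by elim/quotW=> u; elim/quotW=> v; elim/quotW=> w; rewrite !freeprod_mulE catA.
Qed.

Fact freeprod_mul1 : left_id freeprod_one freeprod_mul.
Proof. by elim/quotW=> u; rewrite freeprod_mulE. Qed.

Fact freeprod_1mul : right_id freeprod_one freeprod_mul.
Proof. by elim/quotW=> u; rewrite freeprod_mulE cats0. Qed.

Fact freeprod_mulVg : left_inverse freeprod_one freeprod_inv freeprod_mul.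
Proof.
elim/quotW=> u; rewrite freeprod_invE freeprod_mulE.
exact/fp_eqP/fp_wordVl.
Qed.

Fact freeprod_mulgV : right_inverse freeprod_one freeprod_inv freeprod_mul.
Proof.
elim/quotW=> u; rewrite freeprod_invE freeprod_mulE.
exact/fp_eqP/fp_wordVr.
Qed.

HB.instance Definition _ := isGroup.Build freeprod
  freeprod_mulA freeprod_mul1 freeprod_1mul freeprod_mulVg freeprod_mulgV.

Definition fp_of_gen (x : X) : freeprod := \pi_freeprod [:: FPgen x true].
Definition fp_of_fac (i : I) (h : H i) : freeprod := \pi_freeprod [:: FPfac h].

Fact fp_of_facM i : {morph @fp_of_fac i : a b / a * b}.
Proof.
move=> a b; rewrite /fp_of_fac [RHS]freeprod_mulE.
exact/fp_eqP/fp_sym/fp_mul.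
Qed.
HB.instance Definition _ i :=
  isMultiplicative.Build (H i) freeprod (@fp_of_fac i) (@fp_of_facM i).

(* fp_lift f phi is the homomorphism from freeprod that extends the map f on
   X and the homomorphisms phi i on the factors. *)
Section Lift.
Variables (G : groupType) (f : X -> G).
Variable phi : forall i, {multiplicative H i -> G}.

Definition fp_lift_letter (a : fp_letter) : G :=
  match a with
  | FPgen x b => if b then f x else (f x)^-1
  | FPfac i h => phi i h
  end.

Definition fp_lift (p : freeprod) : G :=
  \prod_(a <- repr p) fp_lift_letter a.

Lemma fp_lift_eq u v : fp_eq u v ->
  \prod_(a <- u) fp_lift_letter a = \prod_(a <- v) fp_lift_letter a.
Proof.
elim=> {u v}
  [//|//|u v w _ -> _ ->//|u u' v v' _ e _ e'|x b|i a b|i].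
- by rewrite !big_cat /= e e'.
- by rewrite !big_cons big_nil mulg1; case: b; rewrite /= ?mulgV ?mulVg.
- by rewrite !big_cons big_nil !mulg1 /= gmulfM.
- rewrite big_cons !big_nil mulg1 /=.
  by apply: (mulgI (phi i 1)); rewrite -gmulfM !mulg1.
Qed.

Lemma fp_liftE u : fp_lift (\pi u) = \prod_(a <- u) fp_lift_letter a.
Proof. exact: fp_lift_eq (fp_reprP _). Qed.

Fact fp_liftM : {morph fp_lift : p q / p * q}.
Proof.
elim/quotW=> u; elim/quotW=> v.
by rewrite [X in fp_lift X]freeprod_mulE !fp_liftE big_cat.
Qed.
HB.instance Definition _ := isMultiplicative.Build freeprod G fp_lift fp_liftM.

Lemma fp_lift_gen x : fp_lift (fp_of_gen x) = f x.
Proof. by rewrite fp_liftE big_cons big_nil mulg1. Qed.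

Lemma fp_lift_fac i (h : H i) : fp_lift (fp_of_fac h) = phi i h.
Proof. by rewrite fp_liftE big_cons big_nil mulg1. Qed.
End Lift.
End FreeProduct.

(* relquot R is the quotient of the group F by the normal closure of R. *)
Section Quotient.
Variables (F : groupType) (R : set F).

Lemma normal_closure1 : normal_closure R 1.
Proof. by move=> N _ _; exact: gpred1. Qed.

Lemma normal_closureM x y :
  normal_closure R x -> normal_closure R y -> normal_closure R (x * y).
Proof. by move=> xR yR N NJ NR; rewrite gpredM ?xR ?yR. Qed.

Lemma normal_closureV x : normal_closure R x -> normal_closure R x^-1.
Proof. by move=> xR N NJ NR; rewrite gpredV xR. Qed.

Lemma normal_closureJ x y : normal_closure R x -> normal_closure R (x ^ y).
Proof. by move=> xR N NJ NR; exact/NJ/xR. Qed.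

Lemma normal_closure_sub : R `<=` normal_closure R.
Proof. by move=> x xR N _ NR; exact: NR. Qed.

Definition relquot_rel : rel F := fun x y => `[< normal_closure R (x^-1 * y) >].

Fact relquot_rel_equiv : equiv_class_of relquot_rel.
Proof.
have sym x y : relquot_rel x y -> relquot_rel y x.
  move=> /asboolP h; apply/asboolP.
  by rewrite -[_ * _]invgK invgM invgK; exact: normal_closureV.
split=> [x|x y|y x z].
- by apply/asboolP; rewrite mulVg; exact: normal_closure1.
- by apply/idP/idP; exact: sym.
- move=> /asboolP xy /asboolP yz; apply/asboolP.
  by rewrite -(mulgK y x^-1) -mulgA; apply: normal_closureM.
Qed.
Canonical relquot_rel_canonical := EquivRelPack relquot_rel_equiv.

Definition relquot := {eq_quot relquot_rel}.
HB.instance Definition _ := Choice.on relquot.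
HB.instance Definition _ := EqQuotient.on relquot.

Lemma relquotP x y :
  \pi_relquot x = \pi_relquot y <-> normal_closure R (x^-1 * y).
Proof.
by split=> [/eqmodP/asboolP//|h]; apply/eqmodP/asboolP.
Qed.

Definition relquot_mul (p q : relquot) : relquot := \pi_relquot (repr p * repr q).
Definition relquot_inv (p : relquot) : relquot := \pi_relquot (repr p)^-1.

Lemma relquot_reprP x : normal_closure R (x^-1 * repr (\pi_relquot x)).
Proof. by apply/relquotP; rewrite reprK. Qed.

Lemma relquot_mulE x y : relquot_mul (\pi x) (\pi y) = \pi_relquot (x * y).
Proof.
apply/esym/relquotP; have := relquot_reprP x; have := relquot_reprP y.
set x' := repr _; set y' := repr _ => nx ny; rewrite invgM.
have -> : y^-1 * x^-1 * (y' * x') = (x^-1 * y') ^ y * (y^-1 * x').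
  by rewrite conjgE !mulgA mulgK.
by apply: normal_closureM => //; exact: normal_closureJ.
Qed.

Lemma relquot_invE x : relquot_inv (\pi x) = \pi_relquot x^-1.
Proof.
apply/relquotP; rewrite invgK; set x' := repr _.
have -> : x' * x^-1 = (x^-1 * x') ^ x^-1 by rewrite conjgE invgK !mulgA mulgV mul1g.
exact/normal_closureJ/relquot_reprP.
Qed.

Fact relquot_mulA : associative relquot_mul.
Proof.
by elim/quotW=> x; elim/quotW=> y; elim/quotW=> z; rewrite !relquot_mulE mulgA.
Qed.

Fact relquot_mul1 : left_id (\pi_relquot 1) relquot_mul.
Proof. by elim/quotW=> x; rewrite relquot_mulE mul1g. Qed.

Fact relquot_1mul : right_id (\pi_relquot 1) relquot_mul.
Proof. by elim/quotW=> x; rewrite relquot_mulE mulg1. Qed.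

Fact relquot_mulVg : left_inverse (\pi_relquot 1) relquot_inv relquot_mul.
Proof. by elim/quotW=> x; rewrite relquot_invE relquot_mulE mulVg. Qed.

Fact relquot_mulgV : right_inverse (\pi_relquot 1) relquot_inv relquot_mul.
Proof. by elim/quotW=> x; rewrite relquot_invE relquot_mulE mulgV. Qed.

HB.instance Definition _ := isGroup.Build relquot
  relquot_mulA relquot_mul1 relquot_1mul relquot_mulVg relquot_mulgV.

Definition relquot_proj (x : F) : relquot := \pi_relquot x.

Fact relquot_projM : {morph relquot_proj : x y / x * y}.
Proof. by move=> x y; rewrite [RHS]relquot_mulE. Qed.
HB.instance Definition _ :=
  isMultiplicative.Build F relquot relquot_proj relquot_projM.
End Quotient.

(* The HNN-extension < H, t | t^-1 k t = iota k, k in K >, as the quotient of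
   the free product of H and the free group on the single generator t. *)
Section HNN.
Variables (H : groupType) (K L : groupClosed H).
Variable iota : {multiplicative subgrp K -> subgrp L}.

Definition hnn_free := freeprod unit (fun _ : unit => H).
HB.instance Definition _ := Group.on hnn_free.

Definition hnn_free_base (h : H) : hnn_free :=
  @fp_of_fac unit unit (fun _ => H) tt h.
Definition hnn_free_stable : hnn_free := fp_of_gen _ tt.

Definition hnn_relators : set hnn_free :=
  [set r | exists k : subgrp K,
     r = hnn_free_stable^-1 * hnn_free_base (val k) * hnn_free_stable
         * (hnn_free_base (val (iota k)))^-1].

Definition hnn := relquot hnn_relators.
HB.instance Definition _ := Group.on hnn.

Definition hnn_base (h : H) : hnn := relquot_proj _ (hnn_free_base h).
Definition hnn_stable : hnn := relquot_proj _ hnn_free_stable.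

Fact hnn_baseM : {morph hnn_base : x y / x * y}.
Proof.
by move=> x y; rewrite /hnn_base /hnn_free_base fp_of_facM; exact: relquot_projM.
Qed.
HB.instance Definition _ := isMultiplicative.Build H hnn hnn_base hnn_baseM.
End HNN.

Section RelativePresentation.
Variables (G : groupType) (Lambda : Type) (Hs : Lambda -> groupClosed G).

(* X is a subset of G, always required to be symmetrized below; as in the
   literal definition of F(X), the letters x and x^-1 of X are distinct basis
   elements of F(X). *)
Definition relfree (X : set G) :=
  freeprod X (fun l : Lambda => subgrp (Hs l)).
HB.instance Definition _ (X : set G) := Group.on (relfree X).

Definition natural_hom (X : set G) : relfree X -> G :=
  @fp_lift _ _ (fun l => subgrp (Hs l)) G (fun x : X => val x)
    (fun l => (val : subgrp (Hs l) -> G)).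
HB.instance Definition _ (X : set G) :=
  Multiplicative.copy (@natural_hom X) (fp_lift _ _).

Definition relative_generating_set (X : set G) : Prop :=
  generated (X `|` \bigcup_(l in [set: Lambda]) [set` Hs l]) = [set: G].

Definition relative_presentation (X : set G) (R : set (relfree X)) : Prop :=
  [/\ forall x, X x -> X x^-1,
      relative_generating_set X
    & forall u : relfree X, natural_hom u = 1 <-> normal_closure R u].

Definition finite_relative_presentation (X : set G) (R : set (relfree X)) :
    Prop :=
  [/\ relative_presentation R, finite_set X & finite_set R].

(* The alphabet X U (disjoint union of the H_l \ {1}). *)
Inductive rel_letter (X : set G) : Type :=
| RelGen of X
| RelPer (l : Lambda) (h : subgrp (Hs l)) of h != 1.

Definition letter_val (X : set G) (a : rel_letter X) : relfree X :=
  match a with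
  | RelGen x => fp_of_gen _ x
  | RelPer l h _ => @fp_of_fac X Lambda (fun l => subgrp (Hs l)) l h
  end.

Definition word_val (X : set G) (W : seq (rel_letter X)) : relfree X :=
  \prod_(a <- W) letter_val a.

Definition product_of_conjugates (X : set G) (R : set (relfree X))
    (u : relfree X) (k : nat) : Prop :=
  exists (f r : 'I_k -> relfree X) (e : 'I_k -> bool),
    (forall i, R (r i)) /\
    u = \prod_(i < k) ((f i)^-1 * (if e i then r i else (r i)^-1) * f i).

Definition is_relative_area (X : set G) (R : set (relfree X))
    (W : seq (rel_letter X)) (k : nat) : Prop :=
  product_of_conjugates R (word_val W) k /\
  forall k', product_of_conjugates R (word_val W) k' -> (k <= k')%N.

Definition bounds_relative_area (X : set G) (R : set (relfree X))
    (f : nat -> nat) : Prop :=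
  forall (n : nat) (W : seq (rel_letter X)),
    (size W <= n)%N -> natural_hom (word_val W) = 1 ->
    exists2 k, is_relative_area R W k & (k <= f n)%N.

(* A well-defined relative Dehn function is the pointwise smallest bound. *)
Definition is_relative_Dehn_function (X : set G) (R : set (relfree X))
    (f : nat -> nat) : Prop :=
  bounds_relative_area R f /\
  forall g, bounds_relative_area R g -> forall n, (f n <= g n)%N.

Definition relatively_hyperbolic : Prop :=
  exists (X : set G) (R : set (relfree X)),
    finite_relative_presentation R /\
    exists f : nat -> nat, is_relative_Dehn_function R f /\
      exists C : nat, forall n, (f n <= C * n)%N.
End RelativePresentation.

(* The collection {H_l} U {K}, with K as an additional member. *)
Definition adjoin (G : groupType) (Lambda : Type)
    (Hs : Lambda -> groupClosed G) (K : groupClosed G) (o : option Lambda) :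
    groupClosed G :=
  if o is Some l then Hs l else K.

(* Main.v *)
(* A finite presentation of the HNN-extension relative to the images of the
   H_l is obtained from one of H by adding the generator t and replacing each
   letter k of K by t iota(k) t^-1; as iota is a homomorphism, this also takes
   care of the multiplication table of K.  For the linear bound, read a word
   from right to left keeping a stack w0 t^e1 w1 ... t^en wn, with words wi over
   H, that contains no pinch.  When pushing t^e creates a pinch t^e w t^-e, the
   word w equals in H a single letter of K or H_nu, at a cost at most
   C (|w| + 1) by the linear bound in H, and then the pinch is a single letter
   too, so the cost is paid for by the decrease of the length.  By Britton's
   lemma the final stack of a trivial word is one word w0 trivial in H. *)
Require Import Defs.
From HB Require Import structures.
From mathcomp Require Import all_boot.
From mathcomp Require Import boolp classical_sets cardinality.

Set Implicit Arguments.
Unset Strict Implicit.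
Unset Printing Implicit Defensive.

Local Open Scope group_scope.
Local Open Scope classical_set_scope.
Local Open Scope quotient_scope.

(** * Subgroups given by closed sets *)

Section SubgroupOfSet.
Variables (G : groupType) (P : set G).
Hypotheses (P1 : P 1) (PM : forall x y, P x -> P y -> P (x * y)).
Hypothesis PV : forall x, P x -> P x^-1.

(** [generated] and [normal_closure] quantify over bundled subgroups; this makes them applicable to
    a closed set. *)
Lemma subgroup_of_set : exists S : groupClosed G, forall x, x \in S <-> P x.
Proof.
pose p : {pred G} := [pred x | `[< P x >]].
have p1 : 1 \in p by exact/asboolP.
have pM : mulg_closed p.
  by move=> x y /asboolP Px /asboolP Py; exact/asboolP/PM.
have pV : invg_closed p by move=> x /asboolP Px; exact/asboolP/PV.
pose S := HB.pack_for (groupClosed G) p (isMulClosed.Build G p pM)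
  (isMul1Closed.Build G p p1) (isInvClosed.Build G p pV).
by exists S => x; split=> [/asboolP|Px]; last exact/asboolP.
Qed.
End SubgroupOfSet.

(** * Words as elements of the free product *)

Section FreeProductTheory.
Variables (X I : Type) (H : I -> groupType).

Lemma pi_cat (u v : seq (fp_letter X H)) :
  \pi_(freeprod X H) (u ++ v) = \pi_(freeprod X H) u * \pi_(freeprod X H) v.
Proof. by rewrite [RHS]freeprod_mulE. Qed.

Lemma pi_wordV (u : seq (fp_letter X H)) :
  \pi_(freeprod X H) (fp_wordV u) = (\pi_(freeprod X H) u)^-1.
Proof. by rewrite [RHS]freeprod_invE. Qed.
End FreeProductTheory.

(** * Normal forms in an HNN-extension and the action of words on them *)

Section NormalForms.
Variables (H : groupType) (A : bool -> groupClosed H) (phi : bool -> H -> H).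
Hypothesis phi_in : forall e a, a \in A e -> phi e a \in A (~~ e).
Hypothesis phiM : forall e, {in A e &, {morph phi e : a b / a * b}}.
Hypothesis phiK : forall e, {in A e, cancel (phi e) (phi (~~ e))}.

(** The representative of the right coset of [A e] containing [h], with 1 representing [A e]
    itself. *)
Definition coset_rep e h : H :=
  if h \in A e then 1 else choose [pred x | h / x \in A e] h.

Lemma coset_rep_div e h : h / coset_rep e h \in A e.
Proof.
rewrite /coset_rep; case: ifP => [|_]; first by rewrite divg1.
have /= := @chooseP H [pred x | h / x \in A e] h.
by apply; rewrite /= mulgV gpred1.
Qed.

(** [h] and [a * h] define the same predicate on [x], and [choose] does not depend on the witness
    supplied. *)
Lemma coset_repM e a h : a \in A e -> coset_rep e (a * h) = coset_rep e h.
Proof.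
move=> aA; rewrite /coset_rep gpredMl //.
case: ifP => // _; rewrite (@eq_choose _ _ [pred x | h / x \in A e]).
  by apply: choose_id; rewrite /= ?mulgV ?gpred1 // invgM mulgA mulgV mul1g gpredV.
by move=> x /=; rewrite -mulgA gpredMl.
Qed.

Lemma coset_rep_id e h : coset_rep e (coset_rep e h) = coset_rep e h.
Proof.
rewrite -[RHS](@coset_repM e (coset_rep e h / h)) ?mulgVK //.
by rewrite gpredFC coset_rep_div.
Qed.

Definition nopinch (p q : bool * H) := ~~ ((q.1 == ~~ p.1) && (p.2 \in A p.1)).

Definition normal L := all (fun p => coset_rep p.1 p.2 == p.2) L && sorted nopinch L.

(* The pair (h, [:: (e1, c1); ...; (en, cn)]) stands for the normal form
   h t^e1 c1 ... t^en cn, and push e is left multiplication by t^e. *)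
Definition pinched e h (L : seq (bool * H)) :=
  (h \in A e) && (if L is p :: _ then p.1 == ~~ e else false).

Definition push e (s : H * seq (bool * H)) : H * seq (bool * H) :=
  if pinched e s.1 s.2 then (phi e s.1 * (head (e, 1) s.2).2, behead s.2)
  else (phi e (s.1 / coset_rep e s.1), (e, coset_rep e s.1) :: s.2).

Lemma push_normal e s : normal s.2 -> normal (push e s).2.
Proof.
case: s => h L /andP[/= rL sL]; rewrite /push /=; case: ifP => [_|].
  case: L rL sL => //= p L /andP[_ rL] pL.
  by rewrite /normal rL; exact: path_sorted pL.
rewrite /pinched /normal /= coset_rep_id eqxx /= => nL; rewrite rL /=.
case: L nL {rL} sL => //= q L nL ->; rewrite andbT /nopinch /= andbC.
apply/negP => /andP[cA qe]; move: nL; rewrite qe andbT.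
have := gpredMl (coset_rep e h) (coset_rep_div e h).
by rewrite mulgVK cA => ->.
Qed.

(** If t^e cancels the head of [L], the lost coefficient [c] is recovered as a coset representative
    because [phi e h] lies in [A (~~ e)], and normality of [L] keeps t^-e from cancelling the next
    letter. Otherwise t^-e cancels the letter just pushed. *)
Lemma push_pushN e h L : normal L -> push (~~ e) (push e (h, L)) = (h, L).
Proof.
move=> /andP[rL sL]; rewrite {2}/push /=; case: ifP => [|nP].
  case/andP=> hA; case: L rL sL => // -[e1 c] L /= /andP[/eqP rc rL] cL /eqP E.
  subst e1; rewrite /push /=.
  have -> : pinched (~~ e) (phi e h * c) L = false.
    rewrite /pinched gpredMl ?phi_in //; apply/negP => /andP[cA].
    by case: L cL rL => // q L /= /andP[/negP qp _] _ qe; apply: qp; rewrite qe.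
  by rewrite coset_repM ?phi_in // rc mulgK phiK.
have bA := coset_rep_div e h.
by rewrite /push /pinched /= phi_in // negbK eqxx /= phiK // mulgVK.
Qed.

(** The relation t^e a = [phi e a] t^e, read on normal forms: [h] and [a * h] have the same coset
    representative. *)
Lemma pushM e a h L : a \in A e ->
  push e (a * h, L) = (phi e a * (push e (h, L)).1, (push e (h, L)).2).
Proof.
move=> aA; rewrite /push /= {1}/pinched gpredMl // -/(pinched e h L).
case: ifP => [/andP[hA _]|_] /=; first by rewrite phiM // mulgA.
by rewrite coset_repM // -mulgA [phi e (a * _)]phiM ?coset_rep_div.
Qed.

Definition act (a : fp_letter unit (fun _ : unit => H)) s :=
  match a with FPgen _ e => push e s | FPfac _ h => (h * s.1, s.2) end.

Definition acts u s := foldr act s u.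

Lemma acts_cat u v s : acts (u ++ v) s = acts u (acts v s).
Proof. exact: foldr_cat. Qed.

Lemma acts_normal u s : normal s.2 -> normal (acts u s).2.
Proof.
by elim: u => //= -[? e|? h] u IHu sN; [apply: push_normal|]; exact: IHu.
Qed.

(** The action respects each rule of [fp_eq]; free cancellation is [push_pushN], whence the
    restriction to normal lists. *)
Lemma acts_eq u v : fp_eq u v -> forall s, normal s.2 -> acts u s = acts v s.
Proof.
elim=> {u v}
  [//|u v _ e s|u v w _ e _ e' s|u u' v v' _ e _ e' s|? b [h L]|? a b s|? [h L]] sN.
- by rewrite e.
- by rewrite e // e'.
- by rewrite !acts_cat e' // e //; exact: acts_normal.
- by have := push_pushN (~~ b) h sN; rewrite negbK.
- by rewrite /= mulgA.
- by rewrite /= mul1g.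
Qed.

(* Multiplying the normal form of t^e1 h1 ... t^en hn by t^e creates a pinch
   only if the word itself contains one, as the leading coefficient of that
   normal form lies in A (~~ e1). *)
Lemma reduced_acts (L : seq (bool * H)) : sorted nopinch L ->
  let s := foldr (fun p s => push p.1 (p.2 * s.1, s.2)) (1, [::]) L in
  map fst s.2 = map fst L /\
  (if L is p :: _ then s.1 \in A (~~ p.1) else s.1 = 1).
Proof.
elim: L => [|[e h] L IHL] //= pL; have {IHL} := IHL (path_sorted pL).
move: (foldr _ _ L) => [g L'] /= [L'L gA]; rewrite /push /=.
suff -> : pinched e (h * g) L' = false.
  by rewrite /= L'L; split=> //; apply: phi_in; exact: coset_rep_div.
case: L' L'L => [|p' L']; first by rewrite /pinched andbF.
case: L pL gA => //= p L /andP[np _] gA [pp' _].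
rewrite /pinched pp'; apply: contraNF np => /andP[hA /eqP pe].
by move: gA; rewrite pe negbK eqxx /= => gA; rewrite -(gpredMr _ gA).
Qed.
End NormalForms.

(** * Elementary facts on homomorphisms *)

Section MultiplicativeTheory.
Variables (G L : groupType) (f : {multiplicative G -> L}).

Lemma multiplicative1 : f 1 = 1.
Proof. by apply: (mulgI (f 1)); rewrite -gmulfM !mulg1. Qed.

Lemma multiplicativeV : {morph f : x / x^-1}.
Proof. by move=> x; apply: (mulgI (f x)); rewrite -gmulfM !mulgV multiplicative1. Qed.

Lemma multiplicative_prod (I : Type) (r : seq I) (F : I -> G) :
  f (\prod_(i <- r) F i) = \prod_(i <- r) f (F i).
Proof. exact: (big_morph f (@gmulfM _ _ f) multiplicative1). Qed.
End MultiplicativeTheory.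

(** * Britton's lemma *)

Section Britton.
Variables (H : groupType) (K L : groupClosed H).
Variable iota : {multiplicative subgrp K -> subgrp L}.
Hypothesis iota_inj : injective iota.

Lemma iota_image_exists :
  exists S : groupClosed H, forall h, h \in S <-> exists k, val (iota k) = h.
Proof.
apply: subgroup_of_set => [|_ _ [k <-] [l <-]|_ [k <-]].
- by exists 1; rewrite !multiplicative1.
- by exists (k * l); rewrite !gmulfM.
- by exists k^-1; rewrite !multiplicativeV.
Qed.

(** Indexed so that t^e a t^-e lies in [H] for a in [hnn_assoc e]: the image of [iota] goes with t,
    and [K] with t^-1. *)
Definition hnn_assoc (e : bool) : groupClosed H :=
  if e then projT1 (cid iota_image_exists) else K.

Definition assoc_val (e : bool) (k : subgrp K) : H :=
  if e then val (iota k) else val k.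

Lemma assocP e h : h \in hnn_assoc e <-> exists k, assoc_val e k = h.
Proof.
case: e; first exact: projT2 (cid iota_image_exists) h.
by split=> [hK|[k <-]]; [exists (Subgrp hK) | exact: subgrp_valP].
Qed.

Lemma assoc_val_in e k : assoc_val e k \in hnn_assoc e.
Proof. by apply/assocP; exists k. Qed.

Lemma assoc_val_inj e : injective (assoc_val e).
Proof. by case: e => k l /val_inj // /iota_inj. Qed.

Lemma assoc_valM e : {morph assoc_val e : k l / k * l}.
Proof. by case: e => k l; rewrite /assoc_val !gmulfM. Qed.

(** The isomorphism a -> t^e a t^-e of associated subgroups, made total on [H] with default value
    1. *)
Definition assoc_swap (e : bool) (h : H) : H :=
  xget 1 [set h' | exists k, assoc_val e k = h /\ assoc_val (~~ e) k = h'].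

Lemma assoc_swapE e k : assoc_swap e (assoc_val e k) = assoc_val (~~ e) k.
Proof.
rewrite /assoc_swap; case: xgetP => [_ -> [l [/assoc_val_inj-> <-]] //|].
by move=> /(_ (assoc_val (~~ e) k)) []; exists k.
Qed.

Lemma assoc_swap_in e a : a \in hnn_assoc e -> assoc_swap e a \in hnn_assoc (~~ e).
Proof. by case/assocP=> k <-; rewrite assoc_swapE assoc_val_in. Qed.

Definition hnn_letter (e : bool) : hnn iota :=
  if e then hnn_stable iota else (hnn_stable iota)^-1.

Definition hnn_value (p : bool * H) : hnn iota :=
  hnn_letter p.1 * hnn_base iota p.2.

Lemma hnn_relation k :
  hnn_base iota (val k) = hnn_stable iota * hnn_base iota (val (iota k)) / hnn_stable iota.
Proof.
have : relquot_proj (hnn_relators iota) ((hnn_free_stable H)^-1 * hnn_free_base (val k)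
    * hnn_free_stable H * (hnn_free_base (val (iota k)))^-1) = 1.
  apply/esym/relquotP; rewrite invg1 mul1g.
  by apply: normal_closure_sub; exists k.
rewrite !relquot_projM !(multiplicativeV (relquot_proj (hnn_relators iota))).
move/divg1_eq; rewrite /hnn_base /hnn_stable => <-.
by rewrite !mulgA mulgV mul1g mulgK.
Qed.

Notation napply := (acts hnn_assoc assoc_swap).

(** The elements of the free product that fix all normal forms make up a normal subgroup, so it
    suffices that the HNN relators belong to it. *)
Lemma acts_normal_closure (w : seq (fp_letter unit (fun _ : unit => H))) s :
  normal_closure (hnn_relators iota) (\pi_(hnn_free H) w) ->
  normal hnn_assoc s.2 -> napply w s = s.
Proof.
have swapA e a := @assoc_swap_in e a.
have swapM e : {in hnn_assoc e &, {morph assoc_swap e : a b / a * b}}.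
  move=> _ _ /assocP[k <-] /assocP[l <-].
  by rewrite -assoc_valM !assoc_swapE assoc_valM.
have swapK e : {in hnn_assoc e, cancel (assoc_swap e) (assoc_swap (~~ e))}.
  by move=> _ /assocP[k <-]; rewrite !assoc_swapE negbK.
have actE (u v : seq (fp_letter unit (fun _ : unit => H))) s' :
    \pi_(hnn_free H) u = \pi_(hnn_free H) v -> normal hnn_assoc s'.2 ->
    napply u s' = napply v s'.
  by move=> /fp_eqP uv sN; exact: (acts_eq swapA swapK uv).
have actN (u : seq (fp_letter unit (fun _ : unit => H))) s' :
    normal hnn_assoc s'.2 -> normal hnn_assoc (napply u s').2.
  exact: acts_normal.
(* The action is defined on words, so [P] ranges over all words for [x]; [actE] passes between
   them. *)
pose P (x : hnn_free H) := forall u s', x = \pi_(hnn_free H) u ->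
  normal hnn_assoc s'.2 -> napply u s' = s'.
have PM x y : P x -> P y -> P (x * y).
  elim/quotW: x => u; elim/quotW: y => v Pu Pv uv s' e sN.
  rewrite -(actE (u ++ v)) //; last by rewrite -e pi_cat.
  by rewrite acts_cat (Pv v) // (Pu u).
have P1 : P 1 by move=> u s' e sN; rewrite -(actE [::]).
have PJ x y : P x -> P (x ^ y).
  elim/quotW: x => u; elim/quotW: y => v Pu uv s' e sN.
  have E : napply uv s' = napply (fp_wordV v ++ u ++ v) s'.
    by apply: actE => //; rewrite -e conjgE !pi_cat pi_wordV.
  rewrite E !acts_cat (Pu u) ?actN // -acts_cat.
  by apply: (actE _ [::]) => //; apply/fp_eqP/fp_wordVl.
have PV x : P x -> P x^-1.
  elim/quotW: x => u Pu v s' e sN.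
  rewrite -(actE (fp_wordV u)) //; last by rewrite -e pi_wordV.
  rewrite -[in LHS](Pu u s') // -acts_cat.
  by apply: (actE _ [::]) => //; apply/fp_eqP/fp_wordVl.
have [N NP] := subgroup_of_set P1 PM PV.
move=> wR sN; apply: ((NP _).1 (wR N _ _) w s) => //.
  by move=> y z /NP Py; apply/NP/PJ.
move=> _ [k ->]; apply/NP => u [h l] e lN.
pose v : seq (fp_letter unit (fun _ : unit => H)) :=
  [:: FPgen (fun _ : unit => H) tt false; @FPfac unit unit (fun _ => H) tt (val k);
      FPgen (fun _ : unit => H) tt true;
      @FPfac unit unit (fun _ => H) tt (val (iota k))^-1].
rewrite -(actE v) //.
  have kA : val (iota k) \in hnn_assoc true by rewrite (assoc_val_in true k).
  (* By [pushM], k moves across t as iota(k) and meets iota(k)^-1; then t^-1 undoes t. *)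
  rewrite /= -[val k]/(assoc_val (~~ true) k) -assoc_swapE.
  rewrite -(pushM swapM) // mulVKg.
  exact: (push_pushN swapA swapK true).
rewrite -e /v -cat1s pi_cat (pi_wordV [:: FPgen _ tt true]) -!mulgA; congr (_ * _).
rewrite -cat1s pi_cat; congr (_ * _).
by rewrite -cat1s pi_cat (pi_wordV [:: @FPfac unit unit (fun _ => H) tt _]).
Qed.

(** A word trivial in the HNN-extension fixes the normal form of 1, while by [reduced_acts] a
    pinch-free word yields a normal form with the same stable letters; so there are none. *)
Lemma britton h (l : seq (bool * H)) : sorted (nopinch hnn_assoc) l ->
  hnn_base iota h * \prod_(p <- l) hnn_value p = 1 -> h = 1 /\ l = [::].
Proof.
move=> lS.
pose word (p : bool * H) : seq (fp_letter unit (fun _ : unit => H)) :=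
  [:: FPgen (fun _ : unit => H) tt p.1; @FPfac unit unit (fun _ => H) tt p.2].
pose w := @FPfac unit unit (fun _ => H) tt h :: flatten [seq word p | p <- l].
have wE : relquot_proj (hnn_relators iota) (\pi_(hnn_free H) w) =
    hnn_base iota h * \prod_(p <- l) hnn_value p.
  have cat_proj u v : relquot_proj (hnn_relators iota) (\pi_(hnn_free H) (u ++ v)) =
      relquot_proj (hnn_relators iota) (\pi_(hnn_free H) u) *
      relquot_proj (hnn_relators iota) (\pi_(hnn_free H) v).
    by rewrite -relquot_projM pi_cat.
  rewrite /w -cat1s cat_proj; congr (_ * _).
  elim: (l) => [|[e g] r IHr]; first by rewrite big_nil.
  rewrite big_cons -IHr cat_proj; congr (_ * _).
  rewrite -[word _]cat1s cat_proj /hnn_value; congr (_ * _).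
  case: e => //=; rewrite /hnn_stable -multiplicativeV; congr relquot_proj.
  by rewrite [RHS]freeprod_invE.
rewrite -wE => w1.
have wN : normal_closure (hnn_relators iota) (\pi_(hnn_free H) w).
  by rewrite -[\pi _]mul1g -invg1; apply/relquotP; rewrite [RHS]w1.
have := acts_normal_closure wN (s := (1, [::])) isT.
have -> : napply w (1, [::]) =
    (fun s => (h * s.1, s.2)) (foldr (fun p s =>
      push hnn_assoc assoc_swap p.1 (p.2 * s.1, s.2)) (1, [::]) l).
  by rewrite /=; congr (fun s => (h * s.1, s.2)); elim: (l) => //= p r ->.
have [] := reduced_acts (fun e a => @assoc_swap_in e a) lS.
move: (foldr _ _ l) => [g l'] /= ll' gl [hg l'0]; rewrite l'0 in ll'.
by case: (l) ll' gl => // _ g1; rewrite g1 mulg1 in hg.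
Qed.
End Britton.

(** * Counting relators in products of conjugates *)

Section Area.
Variables (F : groupType) (R : set F).

(** An upper bound on the area, built one conjugate at a time; the arbitrary [n] in [area_le1] makes
    it monotone. *)
Inductive area_le : F -> nat -> Prop :=
| area_le1 n : area_le 1 n
| area_leR r f u n : R r -> area_le u n -> area_le (r ^ f * u) n.+1
| area_leV r f u n : R r -> area_le u n -> area_le (r^-1 ^ f * u) n.+1.

Lemma area_leW u m n : area_le u m -> (m <= n)%N -> area_le u n.
Proof.
move=> uA; elim: uA n => {u m} [m|r f u m rR _ IHu|r f u m rR _ IHu] [|n] //=.
- by move=> _; exact: area_le1.
- by move=> _; exact: area_le1.
- by move=> mn; apply: area_leR => //; exact: IHu.
- by move=> mn; apply: area_leV => //; exact: IHu.
Qed.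

Lemma area_le_relator r : R r -> area_le r 1.
Proof. by move=> rR; rewrite -[r]mulg1 -[r in r * 1]conjg1; apply/area_leR/area_le1. Qed.

Lemma area_leM u v m n : area_le u m -> area_le v n -> area_le (u * v) (m + n).
Proof.
move=> uA vA; elim: uA => {u m} [m|r f u m rR _ IHu|r f u m rR _ IHu].
- by rewrite mul1g; apply: area_leW vA _; rewrite leq_addl.
- by rewrite addSn -mulgA; exact: area_leR.
- by rewrite addSn -mulgA; exact: area_leV.
Qed.

Lemma area_leJ u g n : area_le u n -> area_le (u ^ g) n.
Proof.
elim=> {u n} [n|r f u n rR _ IHu|r f u n rR _ IHu].
- by rewrite conj1g; exact: area_le1.
- by rewrite conjMg -conjgM; exact: area_leR.
- by rewrite conjMg -conjgM; exact: area_leV.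
Qed.

Lemma area_le_inv u n : area_le u n -> area_le u^-1 n.
Proof.
elim=> {u n} [n|r f u n rR _ IHu|r f u n rR _ IHu]; first by rewrite invg1; exact: area_le1.
  by rewrite invgM conjgC -conjVg; apply: area_leV => //; exact: area_leJ.
by rewrite invgM conjgC -conjVg invgK; apply: area_leR => //; exact: area_leJ.
Qed.

Lemma area_le_divM x x' y y' m n : area_le (x / x') m -> area_le (y / y') n ->
  area_le ((x * y) / (x' * y')) (m + n).
Proof.
move=> xA yA; have -> : (x * y) / (x' * y') = (y / y') ^ x^-1 * (x / x').
  by rewrite conjgE invgK invgM !mulgA mulgVK.
by rewrite addnC; apply: area_leM => //; exact: area_leJ.
Qed.

Lemma area_le_normal_closure u n : area_le u n -> normal_closure R u.
Proof.
elim=> {u n} [n|r f u n rR _ IHu|r f u n rR _ IHu]; first exact: normal_closure1.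
  by apply: normal_closureM => //; apply/normal_closureJ/normal_closure_sub.
by apply: normal_closureM => //; apply/normal_closureJ/normal_closureV/normal_closure_sub.
Qed.

End Area.

Lemma area_le_morph (F F' : groupType) (R : set F) (R' : set F')
    (f : {multiplicative F -> F'}) u n :
  (forall r, R r -> R' (f r)) -> area_le R u n -> area_le R' (f u) n.
Proof.
move=> fR; elim=> {u n} [n|r g u n rR _ IHu|r g u n rR _ IHu].
- by rewrite multiplicative1; exact: area_le1.
- by rewrite gmulfM conjgE !gmulfM multiplicativeV -conjgE; apply: area_leR => //; exact: fR.
- by rewrite gmulfM conjgE !gmulfM !multiplicativeV -conjgE; apply: area_leV => //; exact: fR.
Qed.

Lemma area_le_ker (F F' : groupType) (R : set F) (f : {multiplicative F -> F'}) u n :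
  (forall r, R r -> f r = 1) -> area_le R u n -> f u = 1.
Proof.
move=> fR /(area_le_morph (R' := [set 1]) fR).
by elim=> // {u n}r g u n -> _ ->; rewrite ?invg1 conj1g mulg1.
Qed.

(** * Relative Dehn functions with linear bounds *)

Section DehnFunction.
Variables (G : groupType) (Lambda : Type) (Hs : Lambda -> groupClosed G) (X : set G).
Variable R : set (relfree Hs X).

(** The bound [n] has slack, hence the exact count [k]. Prepending a factor shifts the indices
    through [unlift ord0]. *)
Lemma product_of_conjugatesP u n :
  area_le R u n <-> exists2 k, (k <= n)%N & product_of_conjugates R u k.
Proof.
split.
  elim=> {u n} [n|r f u n rR _ [k kn]|r f u n rR _ [k kn]].
  - exists 0%N => //; exists (fun _ => 1), (fun _ => 1), xpredT.
    by split=> [[]//|]; rewrite big_ord0.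
  - case=> fs [rs [es [rsR ->]]]; exists k.+1 => //.
    exists (fun i => oapp fs f (unlift ord0 i)), (fun i => oapp rs r (unlift ord0 i)),
      (fun i => oapp es true (unlift ord0 i)); split=> [i|]; first by case: (unlift _ i).
    rewrite big_ord_recl unlift_none /= conjgE mulgA; congr (_ * _).
    by apply: eq_bigr => i _; rewrite liftK.
  - case=> fs [rs [es [rsR ->]]]; exists k.+1 => //.
    exists (fun i => oapp fs f (unlift ord0 i)), (fun i => oapp rs r (unlift ord0 i)),
      (fun i => oapp es false (unlift ord0 i)); split=> [i|]; first by case: (unlift _ i).
    rewrite big_ord_recl unlift_none /= conjgE mulgA; congr (_ * _).
    by apply: eq_bigr => i _; rewrite liftK.
case=> k kn [fs [rs [es [rsR ->]]]]; apply: area_leW _ kn.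
elim: k fs rs es rsR => [|k IHk] fs rs es rsR; first by rewrite big_ord0; exact: area_le1.
rewrite big_ord_recl -[(fs _)^-1 * _ * _]mulgA -conjgE.
by case: ifP => _; [apply: area_leR|apply: area_leV] => //; apply: IHk => i; exact: rsR.
Qed.

Lemma linear_bound_of_hyperbolic f C : bounds_relative_area R f ->
  (forall n, (f n <= C * n)%N) -> forall W, natural_hom (word_val W) = 1 ->
  area_le R (word_val W) (C * size W).
Proof.
move=> fR fC W W1; have [k [kA _] kf] := fR _ W (leqnn _) W1.
by apply/product_of_conjugatesP; exists k => //; exact: leq_trans kf (fC _).
Qed.

(** The Dehn function at [n] is the least bound on the areas of trivial words of length at most [n];
    one exists, as [C * n] is such a bound. *)
Lemma Dehn_function_linear C :
  (forall W, natural_hom (word_val W) = 1 -> area_le R (word_val W) (C * size W)) ->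
  exists f, is_relative_Dehn_function R f /\ exists C, forall n, (f n <= C * n)%N.
Proof.
move=> RC.
have area W : natural_hom (word_val W) = 1 ->
    exists2 k, is_relative_area R W k & (k <= C * size W)%N.
  move=> /RC /product_of_conjugatesP[k kC kW].
  have ex : exists k, `[< product_of_conjugates R (word_val W) k >] by exists k; exact/asboolP.
  case: (ex_minnP ex) => m /asboolP mW min.
  have minP k' : product_of_conjugates R (word_val W) k' -> (m <= k')%N.
    by move=> k'W; apply: min; exact/asboolP.
  by exists m => //; exact: leq_trans (minP _ kW) kC.
have areaU W k l : is_relative_area R W k -> is_relative_area R W l -> k = l.
  by move=> [kW kmin] [lW lmin]; apply/eqP; rewrite eqn_leq kmin ?lmin.
pose bound n m := `[< forall W k, (size W <= n)%N -> natural_hom (word_val W) = 1 ->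
  is_relative_area R W k -> (k <= m)%N >].
have bex n : exists m, bound n m.
  exists (C * n)%N; apply/asboolP => W k Wn /area[l lW lC] /areaU/(_ lW) ->.
  by rewrite (leq_trans lC) // leq_mul2l Wn orbT.
exists (fun n => ex_minn (bex n)); split; last first.
  exists C => n; case: ex_minnP => m _; apply; apply/asboolP => W k Wn.
  move=> /area[l lW lC] /areaU/(_ lW) ->.
  by rewrite (leq_trans lC) // leq_mul2l Wn orbT.
split=> [n W Wn W1|g gR n].
  have [k kW _] := area W W1; exists k => //.
  by case: ex_minnP => m /asboolP mb _; exact: mb kW.
case: ex_minnP => m _; apply; apply/asboolP => W k Wn W1.
by have [l lW lg] := gR _ _ Wn W1 => /areaU/(_ lW) ->.
Qed.
End DehnFunction.

(** * A finite relative presentation of the HNN-extension *)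

Section Presentation.
Variables (H : groupType) (Lambda : Type) (Hs : Lambda -> groupClosed H).
Variables (K : groupClosed H) (nu : Lambda).
Variable iota : {multiplicative subgrp K -> subgrp (Hs nu)}.
Hypothesis iota_inj : injective iota.
Variables (X : set H) (R : set (relfree (adjoin Hs K) X)) (C : nat).
Hypothesis X_inv : forall x, X x -> X x^-1.
Hypothesis X_gen : relative_generating_set (adjoin Hs K) X.
Hypothesis R_trivial : forall r, R r -> natural_hom r = 1.
Hypothesis R_linear : forall W : seq (rel_letter (adjoin Hs K) X),
  natural_hom (word_val W) = 1 -> area_le R (word_val W) (C * size W).

Notation G := (hnn iota).
Notation t := (hnn_stable iota).

Definition hnn_peripheral (l : Lambda) : groupClosed G :=
  image_subgroup (hnn_base iota) (Hs l).

Definition hnn_gens : set G := hnn_base iota @` X `|` [set t; t^-1].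

Notation F := (relfree (adjoin Hs K) X).
Notation FG := (relfree hnn_peripheral hnn_gens).
Notation letters := (seq (rel_letter (adjoin Hs K) X)).

Lemma gens_base (x : X) : hnn_gens (hnn_base iota (val x)).
Proof. by left; exists (val x) => //; exact: set_valP. Qed.

Lemma gens_stable : hnn_gens t.
Proof. by right; left. Qed.

Lemma gens_stableV : hnn_gens t^-1.
Proof. by right; right. Qed.

Definition gen_base (x : X) : hnn_gens := SigSub (mem_set (gens_base x)).
Definition gen_stable : hnn_gens := SigSub (mem_set gens_stable).
Definition gen_stableV : hnn_gens := SigSub (mem_set gens_stableV).

Lemma base_peripheral l (h : subgrp (Hs l)) : hnn_base iota (val h) \in hnn_peripheral l.
Proof. by apply/image_predP; exists (val h) => //; exact: subgrp_valP. Qed.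

Definition peripheral l (h : subgrp (Hs l)) : subgrp (hnn_peripheral l) :=
  Subgrp (base_peripheral h).

Lemma peripheralM l : {morph @peripheral l : g h / g * h}.
Proof. by move=> g h; apply: val_inj; rewrite /= !gmulfM. Qed.

Definition free_stable : FG := fp_of_gen _ gen_stable.
Definition free_peripheral l (h : subgrp (Hs l)) : FG :=
  @fp_of_fac hnn_gens Lambda (fun l => subgrp (hnn_peripheral l)) l (peripheral h).

Lemma free_peripheralM l : {morph @free_peripheral l : g h / g * h}.
Proof. by move=> g h; rewrite /free_peripheral peripheralM fp_of_facM. Qed.

Definition transfer_fac (o : option Lambda) : subgrp (adjoin Hs K o) -> FG :=
  match o with
  | Some l => @free_peripheral l
  | None => fun k => free_stable * free_peripheral (iota k) / free_stable
  end.

Lemma transfer_facM o : {morph @transfer_fac o : g h / g * h}.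
Proof.
case: o => [l|] g h /=; first exact: free_peripheralM.
by rewrite gmulfM free_peripheralM !mulgA mulgVK.
Qed.
HB.instance Definition _ o := isMultiplicative.Build (subgrp (adjoin Hs K o)) FG
  (@transfer_fac o) (@transfer_facM o).

Definition transfer : F -> FG :=
  fp_lift (fun x : X => fp_of_gen _ (gen_base x) : FG) (fun o => @transfer_fac o).
HB.instance Definition _ := Multiplicative.copy transfer (fp_lift _ _).

(** The HNN relations are built into [transfer]. The added relator makes the separate basis elements
    for t and t^-1 inverse to each other. *)
Definition hnn_presentation : set FG :=
  transfer @` R `|` [set free_stable * fp_of_gen _ gen_stableV].

Lemma natural_stable : natural_hom free_stable = t.
Proof. exact: fp_lift_gen. Qed.

Lemma natural_peripheral l (h : subgrp (Hs l)) :
  natural_hom (free_peripheral h) = hnn_base iota (val h).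
Proof. exact: fp_lift_fac. Qed.

Lemma natural_transfer u : natural_hom (transfer u) = hnn_base iota (natural_hom u).
Proof.
elim/quotW: u => u; rewrite /transfer fp_liftE [X in hnn_base iota X]fp_liftE.
rewrite (multiplicative_prod (@natural_hom G Lambda hnn_peripheral hnn_gens)).
rewrite (multiplicative_prod (hnn_base iota)); apply: eq_bigr => -[x b|[l|] h] _ /=.
- have xE : natural_hom (fp_of_gen _ (gen_base x) : FG) = hnn_base iota (val x).
    exact: fp_lift_gen.
  by case: b; rewrite ?xE // !multiplicativeV /= xE.
- exact: natural_peripheral.
- by rewrite !gmulfM multiplicativeV /= natural_stable natural_peripheral hnn_relation.
Qed.

Lemma area_transfer u n : area_le R u n -> area_le hnn_presentation (transfer u) n.
Proof. by apply: area_le_morph => r rR; left; exists r. Qed.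

Lemma natural_area u n : area_le hnn_presentation u n -> natural_hom u = 1.
Proof.
apply: area_le_ker => _ [[s sR <-]|->] /=.
  by rewrite natural_transfer R_trivial ?multiplicative1.
by rewrite gmulfM /= [X in X * _]fp_lift_gen [X in _ * X]fp_lift_gen mulgV.
Qed.

(** * Pinches and stacks over the alphabet of H *)

Definition free_letter (e : bool) : FG := if e then free_stable else free_stable^-1.

Lemma free_letterV e : free_letter (~~ e) = (free_letter e)^-1.
Proof. by case: e; rewrite //= invgK. Qed.

Lemma natural_letter e : natural_hom (free_letter e) = hnn_letter iota e.
Proof. by case: e; rewrite /= ?multiplicativeV /= natural_stable. Qed.

Definition fac o (h : subgrp (adjoin Hs K o)) : F :=
  @fp_of_fac X (option Lambda) (fun o => subgrp (adjoin Hs K o)) o h.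

Lemma facV o (h : subgrp (adjoin Hs K o)) : fac h^-1 = (fac h)^-1.
Proof. exact: (multiplicativeV (@fp_of_fac X _ (fun o => subgrp (adjoin Hs K o)) o)). Qed.

Lemma natural_fac o (h : subgrp (adjoin Hs K o)) : natural_hom (fac h) = val h.
Proof. exact: fp_lift_fac. Qed.

(** The alphabet omits trivial peripheral elements, so [h = 1] gets the empty word. *)
Lemma word_of_fac o (h : subgrp (adjoin Hs K o)) :
  exists2 w : letters, (size w <= 1)%N & word_val w = fac h.
Proof.
have [->|h1] := eqVneq h 1.
  exists [::] => //; rewrite /word_val big_nil.
  by apply/esym; exact: (multiplicative1 (@fp_of_fac X _ (fun o => subgrp (adjoin Hs K o)) o)).
by exists [:: RelPer X h1]; rewrite // /word_val big_cons big_nil mulg1.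
Qed.

Definition base_val (w : letters) : H := natural_hom (word_val w).

Definition assoc_fac (e : bool) (k : subgrp K) : F :=
  if e then @fac (Some nu) (iota k) else @fac None k.

Lemma natural_assoc_fac e k : natural_hom (assoc_fac e k) = assoc_val iota e k.
Proof. by case: e; exact: natural_fac. Qed.

Lemma assoc_facV e k : assoc_fac e k^-1 = (assoc_fac e k)^-1.
Proof. by case: e; rewrite /= ?multiplicativeV facV. Qed.

(** Holds in the free product itself, at no cost in relators, since [transfer] sends a letter k of
    [K] to t iota(k) t^-1. *)
Lemma transfer_assoc_fac e k :
  transfer (assoc_fac (~~ e) k) =
  free_letter e * transfer (assoc_fac e k) / free_letter e.
Proof.
have E1 : transfer (assoc_fac true k) = free_peripheral (iota k) by exact: fp_lift_fac.
have E2 : transfer (assoc_fac false k) =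
    free_stable * free_peripheral (iota k) / free_stable by exact: fp_lift_fac.
by case: e; rewrite /= E1 E2 //= invgK !mulgA mulVg mul1g mulgVK.
Qed.

Lemma word_of_assoc_fac e k :
  exists2 w : letters, (size w <= 1)%N & word_val w = assoc_fac e k.
Proof. by case: e; exact: word_of_fac. Qed.

Lemma word_val_cat (v w : letters) : word_val (v ++ w) = word_val v * word_val w.
Proof. by rewrite /word_val big_cat. Qed.

(* A pinch t^e w t^-e costs one relation w = a over H, where a is a single
   letter; t^e a t^-e is then freely equal to the transfer of a single letter. *)
Lemma area_pinch e (w : letters) : base_val w \in hnn_assoc iota e ->
  exists2 w' : letters, (size w' <= 1)%N &
    area_le hnn_presentation
      ((free_letter e * transfer (word_val w) / free_letter e) / transfer (word_val w'))
      (C * (size w).+1).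
Proof.
case/assocP=> k kw; have [w' w'1 w'E] := word_of_assoc_fac (~~ e) k.
have [v v1 vE] := word_of_assoc_fac e k^-1.
exists w' => //.
(* Closing [w] with the letter [v] for the inverse of its value gives a word trivial in [H], of
   length at most |w| + 1. *)
have : area_le R (word_val (w ++ v)) (C * (size w).+1).
  apply: area_leW (R_linear _) _; last first.
    by rewrite leq_mul2l size_cat -addn1 leq_add2l v1 orbT.
  rewrite word_val_cat gmulfM /= vE natural_assoc_fac -/(base_val w) -kw.
  by rewrite -assoc_valM mulgV; case: (e); rewrite /assoc_val ?multiplicative1.
(* Under conjugation by t^e, the letter [v] becomes the inverse of [w']. *)
move=> /area_transfer/(area_leJ (free_letter e)^-1).
rewrite word_val_cat gmulfM vE assoc_facV multiplicativeV /= w'E transfer_assoc_fac.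
by rewrite conjgE invgK !invgM !invgK !mulgA mulgVK.
Qed.

(* (w, [:: (e1, w1); ...; (en, wn)]) stands for the word w t^e1 w1 ... t^en wn. *)
Definition stack := (letters * seq (bool * letters))%type.

Definition stack_val (S : stack) : FG :=
  transfer (word_val S.1) * \prod_(p <- S.2) (free_letter p.1 * transfer (word_val p.2)).

Definition stack_size (S : stack) : nat := size S.1 + \sum_(p <- S.2) (size p.2).+1.

Definition stack_reduced (S : stack) :=
  sorted (nopinch (hnn_assoc iota)) [seq (p.1, base_val p.2) | p <- S.2].

Lemma stack_trivial (S : stack) : stack_reduced S -> natural_hom (stack_val S) = 1 ->
  base_val S.1 = 1 /\ S.2 = [::].
Proof.
case: S => w l /= lS; rewrite /stack_val gmulfM /= natural_transfer.
rewrite (multiplicative_prod (@natural_hom G Lambda hnn_peripheral hnn_gens)).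
move=> l1; have := britton iota_inj (h := base_val w) lS; rewrite big_map.
case=> [|-> l0]; last by case: (l) l0.
rewrite -[RHS]l1; congr (_ * _); apply: eq_bigr => -[e v] _ /=.
by rewrite gmulfM /= natural_transfer natural_letter.
Qed.

(** Words in t, t^-1 and the relative alphabet of [H], including the letters of [K], which is not
    among the peripheral subgroups of the HNN-extension. *)
Definition hnn_word := seq (rel_letter (adjoin Hs K) X + bool).

Definition eval_letter (a : rel_letter (adjoin Hs K) X + bool) : FG :=
  match a with inl b => transfer (letter_val b) | inr e => free_letter e end.

Definition eval_word (W : hnn_word) : FG := \prod_(a <- W) eval_letter a.

(** The stack size is a potential: a new letter raises it by at most one, and a pinch of cost
    [C * n] lowers it enough to pay [n]. *)
Lemma stack_push a (S : stack) : stack_reduced S ->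
  exists (S' : stack) (n : nat), [/\ stack_reduced S',
    area_le hnn_presentation (eval_letter a * stack_val S / stack_val S') (C * n)
    & (stack_size S' + n <= (stack_size S).+1)%N].
Proof.
case: S => w l lS; case: a => [b|e].
  exists (b :: w, l), 0%N; rewrite muln0 addn0; split=> //.
  suff -> : stack_val (b :: w, l) = eval_letter (inl b) * stack_val (w, l).
    by rewrite divgg; exact: area_le1.
  by rewrite /stack_val /= /word_val big_cons gmulfM mulgA.
have pushE : eval_letter (inr e) * stack_val (w, l) / stack_val ([::], (e, w) :: l) = 1.
  suff -> : stack_val ([::], (e, w) :: l) = free_letter e * stack_val (w, l) by rewrite divgg.
  by rewrite /stack_val /= big_cons {1}/word_val big_nil multiplicative1 mul1g mulgA.
have pushS : stack_reduced ([::], (e, w) :: l) ->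
  exists (S' : stack) (n : nat), [/\ stack_reduced S',
    area_le hnn_presentation (eval_letter (inr e) * stack_val (w, l) / stack_val S') (C * n)
    & (stack_size S' + n <= (stack_size (w, l)).+1)%N].
  move=> ?; exists ([::], (e, w) :: l), 0%N; rewrite pushE; split=> //; first exact: area_le1.
  by rewrite /stack_size /= big_cons addn0 add0n addSn.
case: l lS pushE pushS => [|[e1 w1] l] lS pushE pushS; first exact: pushS isT.
have [np|] := boolP (nopinch (hnn_assoc iota) (e, base_val w) (e1, base_val w1)).
  by apply: pushS; rewrite /stack_reduced /= np; exact: lS.
rewrite negbK /= => /andP[/eqP e1E wA].
have [w' w'1 w'A] := area_pinch wA.
(* With r the size of [l], the size |w| + 1 + |w1| + r drops to at most 1 + |w1| + r, so [n] = |w| +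
   1 fits in the old size plus one. *)
exists (w' ++ w1, l), (size w).+1; split.
- exact: path_sorted lS.
- have -> : eval_letter (inr e) * stack_val (w, (e1, w1) :: l) / stack_val (w' ++ w1, l) =
      free_letter e * transfer (word_val w) / free_letter e / transfer (word_val w').
    rewrite /stack_val /= big_cons word_val_cat gmulfM e1E free_letterV /=.
    by rewrite !invgM !mulgA mulgK mulgK.
  exact: w'A.
rewrite /stack_size /= big_cons size_cat.
apply: leq_trans (leq_add (leq_add (leq_add w'1 (leqnn _)) (leqnn _)) (leqnn _)) _.
by rewrite addnS addnC.
Qed.

Lemma stack_reduce W : exists (S : stack) (n : nat), [/\ stack_reduced S,
    area_le hnn_presentation (eval_word W / stack_val S) (C * n)
    & (stack_size S + n <= size W)%N].
Proof.
elim: W => [|a W [S [n [Sr Sa Sn]]]].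
  exists ([::], [::]), 0%N; split=> //; last by rewrite /stack_size big_nil.
  rewrite /eval_word /stack_val /word_val !big_nil multiplicative1 mulg1 divgg.
  exact: area_le1.
have [S' [m [S'r S'a S'm]]] := stack_push a Sr.
exists S', (n + m)%N; split=> //; last first.
  rewrite addnCA addnC; apply: leq_trans (leq_add S'm (leqnn n)) _.
  by rewrite addSn.
rewrite mulnDr.
have -> : eval_word (a :: W) / stack_val S' =
    (eval_word W / stack_val S) ^ (eval_letter a)^-1 *
    (eval_letter a * stack_val S / stack_val S').
  rewrite /eval_word big_cons; move: (\prod_(b <- W) _) (stack_val S) => p s.
  by rewrite conjgE invgK !mulgA mulgVK mulgVK.
by apply: area_leM S'a; exact: area_leJ.
Qed.

Lemma eval_word_area W : natural_hom (eval_word W) = 1 ->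
  area_le hnn_presentation (eval_word W) (C * size W).
Proof.
have [[w l] [n [Sr Sa Sn]]] := stack_reduce W => W1.
have S1 : natural_hom (stack_val (w, l)) = 1.
  have := natural_area Sa; rewrite gmulfM /= W1 mul1g multiplicativeV /= => E.
  by apply: invg_inj; rewrite E invg1.
have [/= w1 l0] := stack_trivial Sr S1; move: Sn Sa; rewrite l0 /stack_size /stack_val.
rewrite !big_nil /= addn0 mulg1 => Sn Sa.
(* The reduction costs [C * n] and the remaining word [w], trivial in [H], costs C |w|, where n +
   |w| is at most |W|. *)
rewrite -[eval_word W](mulgVK (transfer (word_val w))).
apply: area_leW (area_leM Sa (area_transfer (R_linear w1))) _.
by rewrite -mulnDr leq_mul2l addnC Sn orbT.
Qed.

(** * Translation from the relative alphabet of the HNN-extension *)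

Lemma gen_cases (x : hnn_gens) :
  [\/ exists y, x = gen_base y, x = gen_stable | x = gen_stableV].
Proof.
case: (set_valP x) => [[y Xy yx]|[xt|xt]].
- by constructor 1; exists (SigSub (mem_set Xy)); exact: val_inj.
- by constructor 2; exact: val_inj.
- by constructor 3; exact: val_inj.
Qed.

Lemma peripheral_surj l (h : subgrp (hnn_peripheral l)) : exists g, h = peripheral g.
Proof.
have /image_predP[g gl gh] := subgrp_valP h.
by exists (Subgrp gl); exact: val_inj.
Qed.

Lemma transfer_gen (x : X) : transfer (fp_of_gen _ x : F) = fp_of_gen _ (gen_base x).
Proof. exact: fp_lift_gen. Qed.

Lemma area_stableV :
  area_le hnn_presentation (fp_of_gen _ gen_stableV / free_letter false) 1.
Proof.
rewrite /= invgK; have -> : fp_of_gen _ gen_stableV * free_stable =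
    (free_stable * fp_of_gen _ gen_stableV) ^ free_stable.
  by rewrite conjgE mulgA mulKg.
by apply: area_leJ; apply: area_le_relator; right.
Qed.

(** Only the generator for t^-1 costs a relator; the other letters are t or images of letters over
    [H]. *)
Lemma rel_letter_lift (a : rel_letter hnn_peripheral hnn_gens) :
  exists b, area_le hnn_presentation (letter_val a / eval_letter b) 1.
Proof.
case: a => [x|l h h1].
  case: (gen_cases x) => [[y ->]|->|->].
  - exists (inl (RelGen _ y)); rewrite /= transfer_gen divgg; exact: area_le1.
  - exists (inr true); rewrite /= divgg; exact: area_le1.
  - by exists (inr false); exact: area_stableV.
have [g hg] := peripheral_surj h; have g1 : g != 1.
  apply: contraNneq h1 => g1; rewrite hg g1; apply/eqP/val_inj.
  exact: multiplicative1 (hnn_base iota).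
exists (inl (@RelPer _ _ (adjoin Hs K) X (Some l) g g1)).
have -> : eval_letter (inl (@RelPer _ _ (adjoin Hs K) X (Some l) g g1)) = free_peripheral g.
  exact: fp_lift_fac.
rewrite /= hg divgg; exact: area_le1.
Qed.

Lemma word_lift (W : seq (rel_letter hnn_peripheral hnn_gens)) :
  exists2 U, size U = size W & area_le hnn_presentation (word_val W / eval_word U) (size W).
Proof.
elim: W => [|a W [U sU UA]].
  by exists [::] => //; rewrite /word_val /eval_word !big_nil divgg; exact: area_le1.
have [b bA] := rel_letter_lift a; exists (b :: U); first by rewrite /= sU.
rewrite /word_val /eval_word !big_cons; exact: (area_le_divM bA UA).
Qed.

Lemma natural_word_lift (u : FG) U n : area_le hnn_presentation (u / eval_word U) n ->
  natural_hom u = 1 -> natural_hom (eval_word U) = 1.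
Proof.
move=> /natural_area; rewrite gmulfM /= multiplicativeV /= => + u1.
by rewrite u1 mul1g => E; apply: invg_inj; rewrite E invg1.
Qed.

(** In C + 1, the 1 pays for translating each letter, and C for the area of the translated word,
    which has the same length. *)
Lemma word_area (W : seq (rel_letter hnn_peripheral hnn_gens)) :
  natural_hom (word_val W) = 1 -> area_le hnn_presentation (word_val W) (C.+1 * size W).
Proof.
have [U sU UA] := word_lift W => /(natural_word_lift UA)/eval_word_area UB.
by rewrite -[word_val W](mulgVK (eval_word U)) mulSn -{2}sU; exact: area_leM.
Qed.

(** The formal inverse of [x] and the basis element for x^-1 differ in the free group; the linear
    bound on a word of length two relates them. *)
Lemma area_gen_inv (x : X) :
  exists (y : X) (n : nat), area_le R ((fp_of_gen _ x : F)^-1 / fp_of_gen _ y) n.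
Proof.
exists (SigSub (mem_set (X_inv (set_valP x)))), (C * 2)%N.
set y := SigSub _.
have : area_le R (word_val [:: RelGen (adjoin Hs K) y; RelGen _ x]) (C * 2).
  apply: R_linear; rewrite /word_val !big_cons big_nil mulg1 gmulfM /=.
  by rewrite [X in X * _]fp_lift_gen [X in _ * X]fp_lift_gen mulVg.
rewrite /word_val !big_cons big_nil mulg1 /= => /area_le_inv.
by rewrite invgM.
Qed.

Lemma letter_lift (a : fp_letter hnn_gens (fun l => subgrp (hnn_peripheral l))) :
  exists U n, area_le hnn_presentation (\pi_FG [:: a] / eval_word U) n.
Proof.
have one b (u : FG) n : area_le hnn_presentation (u / eval_letter b) n ->
    exists U n, area_le hnn_presentation (u / eval_word U) n.
  by move=> uA; exists [:: b], n; rewrite /eval_word big_cons big_nil mulg1.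
case: a => [x [|]|l h].
- by have [b bA] := rel_letter_lift (RelGen hnn_peripheral x); exact: one bA.
- have -> : \pi_FG [:: FPgen _ x false] = (fp_of_gen _ x)^-1.
    by rewrite -[RHS]pi_wordV.
  case: (gen_cases x) => [[y ->]|->|->].
  + have [z [n zA]] := area_gen_inv y.
    apply: (one (inl (RelGen _ z)) _ n).
    have := area_transfer zA.
    by rewrite gmulfM !multiplicativeV /= !transfer_gen.
  + by apply: (one (inr false) _ 0%N); rewrite divgg; exact: area_le1.
  + apply: (one (inr true) _ 1%N); rewrite /= -invgM.
    by apply/area_le_inv/area_le_relator; right.
have [g ->] := peripheral_surj h.
have [w _ wE] := @word_of_fac (Some l) g.
exists [seq inl b | b <- w], 0%N.
have -> : eval_word [seq inl b | b <- w] = free_peripheral g.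
  transitivity (transfer (@fac (Some l) g)); last exact: fp_lift_fac.
  by rewrite -wE /eval_word big_map [RHS]multiplicative_prod.
rewrite divgg; exact: area_le1.
Qed.

(** Unlike [word_lift], this covers formal inverses of generators, with no control of [n]; that is
    enough to identify the kernel. *)
Lemma free_lift (u : FG) : exists U n, area_le hnn_presentation (u / eval_word U) n.
Proof.
elim/quotW: u => u; elim: u => [|a u [U [n UA]]].
  exists [::], 0%N; rewrite /eval_word big_nil divg1; exact: area_le1.
have [V [m VA]] := letter_lift a; exists (V ++ U), (m + n)%N.
by rewrite -cat1s pi_cat /eval_word big_cat; exact: area_le_divM.
Qed.

Lemma hnn_generated : relative_generating_set hnn_peripheral hnn_gens.
Proof.
apply/seteqP; split=> // x _ S SG.
have St : t \in S by apply: SG; left; exact: gens_stable.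
have SH h : hnn_base iota h \in S.
  (* The preimage of [S] in [H] is a subgroup; it remains to check that it contains the relative
     generators of [H]. *)
  have [N NP] : exists N : groupClosed H, forall h, h \in N <-> hnn_base iota h \in S.
    apply: (@subgroup_of_set H (fun h => hnn_base iota h \in S)).
    - by rewrite multiplicative1 gpred1.
    - by move=> g k gS kS; rewrite gmulfM gpredM.
    - by move=> g gS; rewrite multiplicativeV gpredV.
  have Nnu l k : k \in Hs l -> hnn_base iota k \in S.
    by move=> kl; apply: SG; right; exists l => //; apply/image_predP; exists k.
  apply/NP; have : [set: H] h by [].
  rewrite -X_gen => /(_ N); apply => g [Xg|[[l|] _ gl]]; apply/NP.
  - by apply: SG; left; left; exists g.
  - exact: Nnu gl.
  (* An element k of [K] equals t iota(k) t^-1, with iota(k) in [Hs nu]. *)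
  - rewrite -[g]/(val (Subgrp gl)) hnn_relation gpredF // gpredM //.
    exact/Nnu/subgrp_valP.
elim/quotW: x; elim/quotW => u; rewrite -/(relquot_proj (hnn_relators iota) _).
elim: u => [|a u IHu]; first by rewrite -[_ [::]]/(1 : hnn_free H) multiplicative1 gpred1.
rewrite -cat1s pi_cat relquot_projM gpredM //.
case: a => [[] [|]|[] h]; [exact: St| |exact: SH].
rewrite (pi_wordV [:: FPgen (fun _ : unit => H) tt true]) multiplicativeV gpredV.
exact: St.
Qed.

Lemma hnn_finite_presentation : finite_set X -> finite_set R ->
  finite_relative_presentation hnn_presentation.
Proof.
move=> Xfin Rfin; split; first split.
- move=> _ [[x Xx <-]|[->|->]]; last by rewrite invgK; exact: gens_stable.
    by left; exists x^-1; [exact: X_inv|rewrite multiplicativeV].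
  exact: gens_stableV.
- exact: hnn_generated.
- move=> u; split=> [u1|uN].
    (* Up to relators [u] is a translated word, which has finite area by [eval_word_area]. *)
    have [U [n UA]] := free_lift u.
    rewrite -[u](mulgVK (eval_word U)); apply: normal_closureM.
      exact: area_le_normal_closure UA.
    exact: area_le_normal_closure (eval_word_area (natural_word_lift UA u1)).
  (* Conversely, the kernel of [natural_hom] is a normal subgroup containing the relators. *)
  have [N NP] : exists N : groupClosed FG, forall v, v \in N <-> natural_hom v = 1.
    apply: subgroup_of_set.
    - by rewrite multiplicative1.
    - by move=> v w v1 w1; rewrite gmulfM /= v1 w1 mulg1.
    - by move=> v v1; rewrite multiplicativeV /= v1 invg1.
  apply/NP; apply: uN => [v w /NP v1|r /area_le_relator/natural_area r1]; apply/NP => //.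
  by rewrite conjgE !gmulfM /= v1 mul1g multiplicativeV /= mulVg.
- by rewrite finite_setU; split; [exact: finite_image|exact: finite_set2].
- by rewrite finite_setU; split; [exact: finite_image|exact: finite_set1].
Qed.
End Presentation.

(** * Relative hyperbolicity of the HNN-extension *)

Theorem corollary1p4 (H : groupType) (Lambda : Type)
    (Hs : Lambda -> groupClosed H) (K : groupClosed H)
    (Hhyp : relatively_hyperbolic (adjoin Hs K))
    (Kfg : finitely_generated K)
    (nu : Lambda) (iota : {multiplicative subgrp K -> subgrp (Hs nu)})
    (iota_inj : injective iota) :
  relatively_hyperbolic (G := hnn iota)
    (fun l : Lambda => image_subgroup (hnn_base iota) (Hs l)).
Proof.
have [X [R [[[X_inv X_gen R_nc] Xfin Rfin] [f [[fR _] [C fC]]]]]] := Hhyp.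
have R_linear := linear_bound_of_hyperbolic fR fC.
have R_trivial r : R r -> natural_hom r = 1.
  by move=> rR; apply/R_nc/normal_closure_sub.
exists _, (hnn_presentation (iota := iota) R); split.
  exact (hnn_finite_presentation iota_inj X_inv X_gen R_trivial R_linear Xfin Rfin).
exact: Dehn_function_linear (word_area iota_inj R_trivial R_linear).
Qed.
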